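(* Let $G$ be a connected graph and $H$ any graph. Then $\xi(G\odot H)=\mathrm{n}(G)$ if and only if either $\beta(\widehat{G})=0$, or ($\mathrm{n}(H)=1$ and $\beta^*(G)=0$).
   Context: All graphs are finite, simple and undirected; $\mathrm{n}(H)$ denotes the order of $H$. For a connected graph $\Gamma$, a set $S\subseteq V(\Gamma)$ is a distance-equalizer set if for every two distinct $u,v\in V(\Gamma)\setminus S$ there is $w\in S$ with $d_\Gamma(w,u)=d_\Gamma(w,v)$; $\xi(\Gamma)$ is the minimum cardinality of a distance-equalizer set of $\Gamma$. For $V(G)=\{v_1,\dots,v_n\}$, the corona product $G\odot H$ is obtained from $G$ and $n$ pairwise disjoint copies $H_1,\dots,H_n$ of $H$ by joining $v_i$ to every vertex of $H_i$. The empty bisector graph $\widehat{G}$ has vertex set $V(G)$, with distinct $u,v$ adjacent iff there is no $w\in V(G)$ with $d_G(w,u)=d_G(w,v)$. $\beta$ denotes the vertex cover number. A pair $(X,Y)$ of subsets of $V(G)$ with $X\cup Y=V(G)$ is a forward-equalized pair of $G$ if for every $(u,v)\in (X\setminus Y)\times(Y\setminus X)$ there exists $w\in V(G)$ with $d_G(w,u)=d_G(w,v)+1$. $\beta^*(G)=\min\{|X\cap Y| : X,Y \text{ vertex covers of } \widehat{G},\ (X,Y) \text{ a forward-equalized pair of } G\}$. *)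

(* Defs.v *)
From HB Require Import structures.
From mathcomp Require Import all_boot.

Set Implicit Arguments.
Unset Strict Implicit.
Unset Printing Implicit Defensive.

Record sgraph := SGraph {
  vertex :> finType;
  edge : rel vertex;
  edge_sym : symmetric edge;
  edge_irrefl : irreflexive edge }.

Definition connected_graph (G : sgraph) : Prop :=
  0 < #|G| /\ forall x y : G, connect (@edge G) x y.

(* The least length of a walk from x to y; a shortest walk has fewer than #|G|
   edges, so searching the lengths below #|G| suffices.  The junk value when x
   and y lie in different components is #|G|. *)
Definition walkb (G : sgraph) (x y : G) (k : nat) : bool :=
  [exists p : k.-tuple G, path (@edge G) x p && (last x p == y)].

Definition dist (G : sgraph) (x y : G) : nat :=
  find (walkb x y) (iota 0 #|G|).

Lemma dist_walk (G : sgraph) (x y : G) :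
  connect (@edge G) x y -> walkb x y (dist x y).
Proof.
move=> /connectP[p0 p0P ->]; case/shortenP: p0P => p pP pU _.
have w : walkb x (last x p) (size p).
  by apply/existsP; exists (in_tuple p); rewrite /= pP eqxx.
have lt_p : size p < #|G| by rewrite -[_.+1]/(size (x :: p)) -(card_uniqP pU) max_card.
have hs : has (walkb x (last x p)) (iota 0 #|G|).
  by apply/hasP; exists (size p); rewrite // mem_iota.
by have := nth_find 0 hs; rewrite nth_iota // -[X in _ < X](size_iota 0) -has_find.
Qed.

Lemma dist_min (G : sgraph) (x : G) (p : seq G) :
  path (@edge G) x p -> dist x (last x p) <= size p.
Proof.
move=> pP; rewrite leqNgt; apply/negP => lt_p.
have lt_G : size p < #|G|.
  by rewrite (leq_trans lt_p) // -[X in _ <= X](size_iota 0) find_size.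
have := before_find 0 lt_p; rewrite nth_iota // add0n.
suff -> : walkb x (last x p) (size p) by [].
by apply/existsP; exists (in_tuple p); rewrite /= pP eqxx.
Qed.

Definition distance_equalizer (G : sgraph) (S : {set G}) : bool :=
  [forall u, forall v,
     [&& u \notin S, v \notin S & u != v] ==>
     [exists w in S, dist w u == dist w v]].

Definition xi (G : sgraph) : nat :=
  #|[arg min_(S < [set: G] | distance_equalizer S) #|S| ]|.

Lemma distance_equalizerT (G : sgraph) : distance_equalizer [set: G].
Proof. by apply/forallP => u; apply/forallP => v; rewrite inE. Qed.

(* inl v is the vertex v of G; inr (v, h) is the vertex h in the copy of H
   attached to v. *)
Definition corona_edge (G H : sgraph) : rel (G + G * H) :=
  fun a b => match a, b with
  | inl u, inl v => edge u v
  | inl u, inr (v, _) => u == v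
  | inr (u, _), inl v => u == v
  | inr (u, h), inr (v, k) => (u == v) && edge h k
  end.

Lemma corona_edge_sym (G H : sgraph) : symmetric (@corona_edge G H).
Proof.
by case=> [u|[u h]] [v|[v k]] /=; rewrite ?(eq_sym u) // edge_sym.
Qed.

Lemma corona_edge_irrefl (G H : sgraph) : irreflexive (@corona_edge G H).
Proof. by case=> [u|[u h]] /=; rewrite edge_irrefl ?andbF. Qed.

Definition corona (G H : sgraph) : sgraph :=
  SGraph (@corona_edge_sym G H) (@corona_edge_irrefl G H).

Definition bisector_edge (G : sgraph) : rel G :=
  fun u v => (u != v) && ~~ [exists w, dist w u == dist w v].

Lemma bisector_edge_sym (G : sgraph) : symmetric (@bisector_edge G).
Proof.
move=> u v; rewrite /bisector_edge eq_sym; congr (_ && ~~ _).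
by apply: eq_existsb => w; rewrite eq_sym.
Qed.

Lemma bisector_edge_irrefl (G : sgraph) : irreflexive (@bisector_edge G).
Proof. by move=> u; rewrite /bisector_edge eqxx. Qed.

Definition empty_bisector (G : sgraph) : sgraph :=
  SGraph (@bisector_edge_sym G) (@bisector_edge_irrefl G).

Definition vertex_cover (G : sgraph) (S : {set G}) : bool :=
  [forall u, forall v, edge u v ==> (u \in S) || (v \in S)].

Definition beta (G : sgraph) : nat :=
  #|[arg min_(S < [set: G] | vertex_cover S) #|S| ]|.

Lemma vertex_coverT (G : sgraph) : vertex_cover [set: G].
Proof. by apply/forallP => u; apply/forallP => v; rewrite inE implybT. Qed.

Definition forward_equalized (G : sgraph) (X Y : {set G}) : bool :=
  (X :|: Y == [set: G]) &&
  [forall u in X :\: Y, forall v in Y :\: X,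
     exists w, dist w u == (dist w v).+1].

Definition beta_star_admissible (G : sgraph) (p : {set G} * {set G}) : bool :=
  [&& @vertex_cover (empty_bisector G) p.1,
      @vertex_cover (empty_bisector G) p.2
    & forward_equalized p.1 p.2].

Definition beta_star (G : sgraph) : nat :=
  let p := [arg min_(p < ([set: G], [set: G]) | beta_star_admissible p)
             #|p.1 :&: p.2| ] in
  #|p.1 :&: p.2|.

Lemma beta_star_admissibleT (G : sgraph) :
  beta_star_admissible ([set: G], [set: G]).
Proof.
rewrite /beta_star_admissible /= (@vertex_coverT (empty_bisector G)) /=.
rewrite /forward_equalized setUT eqxx /=.
by apply/forall_inP => u; rewrite !inE.
Qed.

(* Main.v *)
(* Write block w for the vertex v of G such that w is v or lies in the copy H_v.
   A pair {v, h} with h in H_v can only be equalized from a neighbour of h in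
   H_v, so every distance-equalizer set S of the corona meets every block.
   Hence xi = n(G) iff some S meets each block exactly once.  If n(H) >= 2, such
   an S misses a vertex of every copy of H; equalizing these vertices
   across two blocks gives an equidistant vertex of G, i.e. the empty bisector
   graph has no edge, and conversely S = V(G) then works.  If n(H) = 1, S chooses
   between v and its leaf in each block; with X (resp. Y) the set of v whose leaf
   (resp. v itself) is chosen, the conditions on S are those defining the pairs
   (X, Y) admissible for beta_star, with X and Y disjoint. *)
Require Import Defs.
From mathcomp Require Import all_boot.

Set Implicit Arguments.
Unset Strict Implicit.
Unset Printing Implicit Defensive.

(** * Distances of a connected graph, and how to recognize them *)

Section Distance.

Variable G : sgraph.
Implicit Types x y z : G.

Lemma dist_refl x : dist x x = 0.
Proof. by apply/eqP; rewrite -leqn0 (@dist_min _ x [::]). Qed.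

Lemma dist_walkP x y : connect (@edge G) x y ->
  exists p, [/\ path (@edge G) x p, last x p = y & size p = dist x y].
Proof.
move=> /dist_walk /existsP[p /andP[pP /eqP py]].
by exists p; split; rewrite ?size_tuple.
Qed.

(** Descending through [f_pred] down to the only zero of [f] produces a walk of length [f y], so
    [dist x y] is at most [f y]. Conversely [f] grows by at most one per edge of a shortest walk.
    This turns a distance formula into three local checks. *)
Lemma dist_unique x (f : G -> nat) :
    (forall y, f y = 0 <-> y = x) ->
    (forall y z, edge y z -> f z <= (f y).+1) ->
    (forall y n, f y = n.+1 -> exists2 z, edge z y & f z = n) ->
  forall y, dist x y = f y.
Proof.
move=> f0 f_lip f_pred.
have walk n : forall y, f y = n ->
    exists p, [/\ path (@edge G) x p, last x p = y & size p = n].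
  elim: n => [|n IHn] y; first by move=> /f0 ->; exists [::].
  move=> /f_pred[z ezy /IHn[p [pP pz pn]]].
  by exists (rcons p y); rewrite rcons_path pP pz last_rcons size_rcons pn.
move=> y; have [p [pP py pn]] := walk _ y erefl.
apply/eqP; rewrite eqn_leq; apply/andP; split.
  by rewrite -pn -py dist_min.
have [|q [qP qy <-]] := @dist_walkP x y; first by apply/connectP; exists p.
rewrite -{}qy {pP py pn p}; elim/last_ind: q qP => [|q z IHq].
  by move=> _ /=; rewrite (f0 x).2.
rewrite rcons_path last_rcons size_rcons => /andP[qP /f_lip fz].
by apply: leq_trans fz _; rewrite ltnS IHq.
Qed.

Hypothesis G_conn : connected_graph G.

Lemma dist_eq0 x y : dist x y = 0 <-> y = x.
Proof.
split=> [d0|->]; last exact: dist_refl.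
have [p [_ py]] := dist_walkP (G_conn.2 x y).
by rewrite d0 -py => /size0nil->.
Qed.

Lemma dist_edge x y z : edge y z -> dist x z <= (dist x y).+1.
Proof.
move=> eyz; have [p [pP py <-]] := dist_walkP (G_conn.2 x y).
rewrite -(size_rcons p z) -[X in dist x X](last_rcons x p).
by rewrite dist_min // rcons_path pP py.
Qed.

Lemma dist_pred x y n : dist x y = n.+1 -> exists2 z, edge z y & dist x z = n.
Proof.
move=> d; have [p [pP]] := dist_walkP (G_conn.2 x y); rewrite d.
case/lastP: p pP => // p t; rewrite rcons_path last_rcons size_rcons.
move=> /andP[pP ez] ty [pn]; rewrite -{}ty in d *; exists (last x p) => //.
apply/eqP; rewrite eqn_leq -{1}pn dist_min //=.
by rewrite -ltnS -d dist_edge.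
Qed.

End Distance.

(** * Vanishing cover numbers and equalizers in pointwise form *)

Lemma beta_eq0 (G : sgraph) : beta G = 0 <-> forall u v : G, ~~ edge u v.
Proof.
rewrite /beta; case: arg_minnP => [|S Scov Smin]; first exact: vertex_coverT.
split=> [/cards0_eq S0 u v|noedge].
  have /forallP/(_ u)/forallP/(_ v) := Scov.
  by rewrite S0 !inE implybF.
apply/eqP; rewrite -leqn0 -(cards0 G) Smin //.
by apply/forallP=> u; apply/forallP=> v; rewrite (negPf (noedge u v)).
Qed.

Section Characterizations.

Variable G : sgraph.

Lemma bisector_edgePn (u v : G) :
  reflect (u <> v -> exists w, dist w u = dist w v) (~~ bisector_edge u v).
Proof.
rewrite /bisector_edge negb_and !negbK.
apply: (iffP orP) => [[/eqP // | /existsP[w /eqP e] _]|h]; first by exists w.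
have [e|/eqP/h[w e]] := eqVneq u v; first by left.
by right; apply/existsP; exists w; rewrite e.
Qed.

Lemma beta_empty_bisector_eq0 :
  beta (empty_bisector G) = 0 <->
  forall u v : G, u <> v -> exists w, dist w u = dist w v.
Proof.
apply: (iff_trans (beta_eq0 _)); split=> h u v; first exact/bisector_edgePn/(h u v).
exact/bisector_edgePn/h.
Qed.

(** The complement of a vertex cover is an independent set, and independence in the empty bisector
    graph means that every bisector is nonempty. *)
Lemma vertex_cover_bisectorP (S : {set G}) :
  reflect (forall u v : G, u \notin S -> v \notin S -> u <> v ->
             exists w, dist w u = dist w v)
          (@vertex_cover (empty_bisector G) S).
Proof.
apply: (iffP forallP) => [cov u v uS vS|h u].
  apply/bisector_edgePn; have /forallP/(_ v) := cov u.
  by rewrite (negPf uS) (negPf vS) implybF.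
apply/forallP=> v; apply/implyP; apply: contraLR.
rewrite negb_or => /andP[uS vS].
by apply/bisector_edgePn/h.
Qed.

Lemma beta_star_eq0 :
  beta_star G = 0 <->
  exists2 p : {set G} * {set G}, beta_star_admissible p & p.1 :&: p.2 = set0.
Proof.
rewrite /beta_star; case: arg_minnP => [|p pA pmin].
  exact: beta_star_admissibleT.
split=> [/cards0_eq p0|[q qA q0]]; first by exists p.
by apply/eqP; rewrite -leqn0 -(cards0 G) -q0 pmin.
Qed.

Lemma distance_equalizerP (S : {set G}) :
  reflect (forall u v, u \notin S -> v \notin S -> u <> v ->
             exists2 w, w \in S & dist w u = dist w v)
          (distance_equalizer S).
Proof.
apply: (iffP forallP) => [eqS u v uS vS /eqP uv|h u].
  have /forallP/(_ v) := eqS u.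
  by rewrite uS vS uv /= => /exists_inP[w wS /eqP]; exists w.
apply/forallP=> v; apply/implyP=> /and3P[uS vS /eqP uv].
by have [w wS /eqP e] := h u v uS vS uv; apply/exists_inP; exists w.
Qed.

End Characterizations.

(** * Distances and blocks in the corona product *)

Section Corona.

Variables G H : sgraph.
Hypothesis G_conn : connected_graph G.
Implicit Types (w : corona G H) (u v z : G) (h l : H) (S : {set corona G H}).

Definition block w : G := match w with inl v => v | inr (v, _) => v end.

(** The distance from [w] to the vertex of [G] in its block: the constant offset in every distance
    from [w] to another block. *)
Definition depth w : nat := if w is inl _ then 0 else 1.

(** Distance in the corona, not in [H]: two vertices of a copy are always joined by a path of length
    2 through their vertex of [G]. *)
Definition copy_dist l h : nat :=
  if l == h then 0 else if edge l h then 1 else 2.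

Definition corona_dist w w' : nat :=
  match w, w' with
  | inr (z, l), inr (u, h) => if z == u then copy_dist l h else (dist z u).+2
  | _, _ => dist (block w) (block w') + depth w + depth w'
  end.

Lemma copy_dist_eq0 l h : copy_dist l h = 0 <-> h = l.
Proof.
rewrite /copy_dist; case: eqVneq => [->|lh]; first by split.
by split=> [|e]; [case: ifP | rewrite e eqxx in lh].
Qed.

Lemma copy_dist_le2 l h : copy_dist l h <= 2.
Proof. by rewrite /copy_dist; case: eqP => //; case: ifP. Qed.

Lemma copy_dist_edge l h h' : edge h h' -> copy_dist l h' <= (copy_dist l h).+1.
Proof.
move=> ehh'; rewrite {2}/copy_dist; case: eqVneq => [->|_].
  by rewrite /copy_dist ehh'; case: ifP.
by apply: leq_trans (copy_dist_le2 _ _) _; case: ifP.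
Qed.

(** The three conditions of [dist_unique] are checked in turn, each first for a source in [G] and
    then for a source in a copy. *)
Lemma dist_corona w w' : dist w w' = corona_dist w w'.
Proof.
apply: dist_unique w'; case: w => [z|[z l]] /=.
- case=> [u|[u h]] /=; rewrite ?addn0 ?addn1; last by split.
  by split=> [/(dist_eq0 G_conn)->|[->]] //; rewrite dist_refl.
- case=> [u|[u h]] /=; first by rewrite addn0 addn1; split.
  case: eqVneq => [->|zu]; last by split=> // -[uz _]; rewrite uz eqxx in zu.
  by split=> [/copy_dist_eq0->|[->]] //; apply/copy_dist_eq0.
- case=> [u|[u h]] [v|[v k]] /=; rewrite ?addn0 ?addn1.
  + exact: dist_edge.
  + by move/eqP->.
  + by move/eqP->; rewrite leqW.
  + by case/andP=> /eqP->; rewrite leqW.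
- case=> [u|[u h]] [v|[v k]] /=; rewrite ?addn0 ?addn1.
  + by rewrite ltnS; exact: dist_edge.
  + move/eqP->; case: eqP => [->|//]; rewrite dist_refl; exact: copy_dist_le2.
  + move/eqP->; case: eqP => [->|_]; first by rewrite dist_refl.
    by rewrite !ltnS leqW.
  + case/andP=> /eqP-> /(copy_dist_edge l) hk.
    by case: eqP => // _; rewrite ltnS.
- case=> [u|[u h]] n /=; rewrite ?addn0 ?addn1.
    by move=> /(dist_pred G_conn)[v ev dv]; exists (inl v); rewrite ?addn0.
  by case=> <-; exists (inl u); rewrite /= ?eqxx ?addn0.
- case=> [u|[u h]] n /=; rewrite ?addn0 ?addn1.
    (* At value 1 the target is the vertex of [G] that carries the source, whose predecessor is the
       source itself; at larger values the predecessor lies in [G]. *)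
    case: n => [|n] [].
      move=> /(dist_eq0 G_conn)->; exists (inr (z, l)); rewrite /= ?eqxx //.
      exact/copy_dist_eq0.
    move=> /(dist_pred G_conn)[v ev dv]; exists (inl v) => //=.
    by rewrite addn0 addn1 dv.
  case: (eqVneq z u) => [<-|zu].
    rewrite /copy_dist; case: eqP => // _; case: ifP => [elh|_] [<-].
      by exists (inr (z, l)); rewrite /= ?eqxx // (copy_dist_eq0 _ _).2.
    by exists (inl z); rewrite /= ?eqxx // dist_refl.
  by case=> <-; exists (inl u); rewrite /= ?eqxx // addn0 addn1.
Qed.

Lemma dist_corona_inl w u : dist w (inl u) = dist (block w) u + depth w.
Proof. by rewrite dist_corona; case: w => [z|[z l]] /=; rewrite !addn0. Qed.

Lemma dist_inl_inr z u h : dist (inl z : corona G H) (inr (u, h)) = (dist z u).+1.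
Proof. by rewrite dist_corona /= addn0 addn1. Qed.

Lemma dist_inr_same u l h :
  dist (inr (u, l) : corona G H) (inr (u, h)) = copy_dist l h.
Proof. by rewrite dist_corona /= eqxx. Qed.

(** From outside the block, a copy can only be entered through its vertex of [G], which costs one
    more edge. *)
Lemma dist_corona_inr w u h : block w != u ->
  dist w (inr (u, h)) = (dist (block w) u + depth w).+1.
Proof.
rewrite dist_corona; case: w => [z|[z l]] /= zu; first by rewrite addn0 addn1.
by rewrite (negPf zu) addn1.
Qed.

(** Seen from another block, [inr (u, h)] is one farther than [inl u], so the equalizing vertex lies
    in the block of [u]. It is not [inl u], hence it lies in the copy, at distance 1 from [inl u]
    and so also from [inr (u, h)]. *)
Lemma equalizer_block S u h : distance_equalizer S ->
    inl u \notin S -> inr (u, h) \notin S ->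
  exists2 l, inr (u, l) \in S & edge l h.
Proof.
move=> /distance_equalizerP eqS uS hS.
have [|w wS] := eqS _ _ uS hS; first by [].
have [wu|wu] := eqVneq (block w) u; last first.
  by rewrite dist_corona_inl dist_corona_inr // => /esym/eqP; rewrite eqn_leq ltnn.
case: w wu wS => [z|[z l]] /= -> wS; first by rewrite wS in uS.
rewrite dist_corona_inl /= dist_refl dist_inr_same /copy_dist => d.
by exists l => //; move: d; case: eqP => // _; case: ifP.
Qed.

Lemma block_equalizer S : 0 < #|H| -> distance_equalizer S ->
  forall v, exists2 w, w \in S & block w = v.
Proof.
move=> /card_gt0P[h _] eqS v.
have [vS|vS] := boolP (inl v \in S); first by exists (inl v).
have [hS|hS] := boolP (inr (v, h) \in S); first by exists (inr (v, h)).
by have [l lS _] := equalizer_block eqS vS hS; exists (inr (v, l)).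
Qed.

(** [block] maps every distance-equalizer set onto [G], so its cardinality is at least that of [G],
    with equality exactly when [block] is injective on it. *)
Lemma xi_corona_eq : 0 < #|H| ->
  xi (corona G H) = #|G| <->
  exists2 S, distance_equalizer S & {in S &, injective block}.
Proof.
move=> H_gt0.
have block_imset S : distance_equalizer S -> block @: S = [set: G].
  move=> /(block_equalizer H_gt0) bS; apply/setP=> v; rewrite inE.
  by have [w wS <-] := bS v; rewrite imset_f.
rewrite /xi; case: arg_minnP => [|S eqS Smin]; first exact: distance_equalizerT.
split=> [cardS|[T eqT injT]].
  by exists S => //; apply/imset_injP; rewrite block_imset // cardsT cardS.
apply/eqP; rewrite eqn_leq; apply/andP; split.
  by rewrite -cardsT -(block_imset T) // card_in_imset // Smin.
by rewrite -cardsT -(block_imset S) // leq_imset_card.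
Qed.

(** * Equalizers with one vertex per block, and bisectors in [G] *)

Lemma distance_equalizer_inl :
    (forall u v, u <> v -> exists z, dist z u = dist z v) ->
  distance_equalizer [set w : corona G H | depth w == 0].
Proof.
move=> bis; apply/distance_equalizerP=> -[u|[u h]] [v|[v k]]; rewrite ?inE //.
move=> _ _ _; have [<-|/eqP/bis[z e]] := eqVneq u v.
  by exists (inl u); rewrite ?inE // !dist_inl_inr.
by exists (inl z); rewrite ?inE // !dist_inl_inr e.
Qed.

Lemma transversal_equalizer_bisector S u v h k :
    distance_equalizer S -> {in S &, injective block} -> u <> v ->
    inr (u, h) \notin S -> inr (v, k) \notin S ->
  exists z, dist z u = dist z v.
Proof.
move=> eqS injS.
(* The vertex of [S] in the block of [t] is at distance 1 from any vertex of that copy missed by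
   [S]: it is either [inl t] or, by [equalizer_block], a neighbour in the copy. Every vertex of a
   copy in another block is at distance at least 2 from it. *)
have near w t t' l l' :
    w \in S -> block w = t -> inr (t, l) \notin S -> t <> t' ->
    dist w (inr (t, l)) <> dist w (inr (t', l')).
  move=> wS wt lS /eqP tt'; rewrite (dist_corona_inr l') ?wt //.
  have d_gt0 : dist t t' != 0.
    by apply: contra tt' => /eqP/(dist_eq0 G_conn)->.
  case: w wt wS => [s|[s m]] /= -> wS.
    rewrite dist_inl_inr dist_refl addn0 => -[/esym/eqP].
    by rewrite (negPf d_gt0).
  have tS : inl t \notin S.
    by apply/negP => /(injS _ _ wS) -/(_ erefl).
  have [m' m'S eml] := equalizer_block eqS tS lS.
  have [<-] := injS _ _ m'S wS erefl.
  rewrite dist_inr_same /copy_dist eml; case: eqP => // _ [/eqP].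
  by rewrite addn1.
move=> uv hS kS; move/distance_equalizerP: (eqS) => /(_ _ _ hS kS).
case=> [[]//|w wS e].
have [wu|wu] := eqVneq (block w) u; first by have := near _ _ _ _ k wS wu hS uv.
have [wv|wv] := eqVneq (block w) v.
  by have := near _ _ _ _ h wS wv kS (nesym uv); rewrite e.
(* Now [w] lies in a third block, and both distances exceed those from [block w] in [G] by the same
   amount [depth w + 1]. *)
exists (block w); move: e; rewrite !dist_corona_inr // => -[/eqP].
by rewrite eqn_add2r => /eqP.
Qed.

Lemma transversal_equalizer_edgeless S : 1 < #|H| ->
    distance_equalizer S -> {in S &, injective block} ->
  forall u v, u <> v -> exists z, dist z u = dist z v.
Proof.
move=> /card_gt1P[h [k [_ _ hk]]] eqS injS.
(* A copy has two vertices, and [S] has at most one vertex in its block. *)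
have miss u : exists l, inr (u, l) \notin S.
  have [hS|hS] := boolP (inr (u, h) \in S); last by exists h.
  exists k; apply/negP=> kS; have [] := injS _ _ hS kS erefl.
  by move/eqP: hk.
move=> u v uv; have [[l lS] [m mS]] := (miss u, miss v).
exact: transversal_equalizer_bisector eqS injS uv lS mS.
Qed.

(** * Copies with a single vertex: equalizers as forward-equalized pairs *)

Section SingletonCopy.

Variable h : H.
Hypothesis H1 : forall l, l = h.

(** With a one-vertex copy, the formula for distances from outside also holds inside the block,
    where only [inl u] remains. *)
Lemma dist_corona_leaf w u : w <> inr (u, h) ->
  dist w (inr (u, h)) = (dist (block w) u + depth w).+1.
Proof.
move=> wu; have [bw|/dist_corona_inr //] := eqVneq (block w) u.
case: w bw wu => [z|[z l]] /= ->; first by rewrite dist_inl_inr addn0.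
by rewrite (H1 l).
Qed.

Lemma transversal_equalizer_beta_star S :
    distance_equalizer S -> {in S &, injective block} ->
  beta_star G = 0.
Proof.
move=> eqS injS; apply/beta_star_eq0.
have H_gt0 : 0 < #|H| by apply/card_gt0P; exists h.
have nleaf w u : w \in S -> inr (u, h) \notin S -> w <> inr (u, h).
  by move=> wS uS wu; rewrite -wu wS in uS.
(* Exactly one of [v] and its leaf is in [S]: at most one by injectivity, at least one because [S]
   meets every block. This makes the two sets below complementary. *)
have inl_leaf v : (inl v \notin S) = (inr (v, h) \in S).
  have [vS|vS] := boolP (inl v \in S).
    by symmetry; apply/negP => /(injS _ _ vS) -/(_ erefl).
  have [[z|[z l]] wS /= zv] := block_equalizer H_gt0 eqS v.
    by rewrite -zv wS in vS.
  by rewrite -zv -(H1 l) wS.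
exists ([set v | inr (v, h) \in S], [set v | inl v \in S]); last first.
  by apply/setP=> v; rewrite !inE -inl_leaf andNb.
move/distance_equalizerP: eqS => eqS.
apply/and3P; split=> /=.
- apply/vertex_cover_bisectorP=> u v; rewrite !inE => uS vS uv.
  have [|w wS] := eqS _ _ uS vS; first by case.
  rewrite !dist_corona_leaf; try exact: nleaf.
  by move=> [/eqP]; rewrite eqn_add2r => /eqP; exists (block w).
- apply/vertex_cover_bisectorP=> u v; rewrite !inE => uS vS uv.
  have [|w wS] := eqS _ _ uS vS; first by case.
  rewrite !dist_corona_inl => /eqP; rewrite eqn_add2r => /eqP.
  by exists (block w).
- apply/andP; split.
    by apply/eqP/setP=> v; rewrite !inE -inl_leaf orNb.
  apply/forall_inP=> u; rewrite !inE => /andP[uS _].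
  apply/forall_inP=> v; rewrite !inE => /andP[vS _].
  have [|w wS] := eqS _ _ uS vS; first by [].
  (* Equalizing the vertex [u] with the leaf of [v] makes [block w] one farther from [u] than from
     [v], since the offset [depth w] cancels and the leaf adds 1. This is the forward condition. *)
  rewrite dist_corona_inl dist_corona_leaf; last exact: nleaf.
  move/eqP; rewrite -addSn eqn_add2r => e.
  by apply/existsP; exists (block w).
Qed.

Lemma beta_star_transversal_equalizer : beta_star G = 0 ->
  exists2 S, distance_equalizer S & {in S &, injective block}.
Proof.
move=> /beta_star_eq0[[X Y] /and3P[/= covX covY /andP[/eqP XY fwd]] XY0].
pose S : {set corona G H} :=
  [set w | match w with inl v => v \in Y | inr (v, _) => v \in X end].
have notX v : (v \notin X) = (v \in Y).
  move/setP/(_ v): XY; move/setP/(_ v): XY0; rewrite !inE.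
  by case: (v \in X); case: (v \in Y).
(* Any witness [z] in [G] can be replaced by the element of [S] in its block: the offset [depth] is
   added to both compared distances. *)
have rep z : exists2 w, w \in S & block w = z.
  have [zX|] := boolP (z \in X); first by exists (inr (z, h)); rewrite ?inE.
  by rewrite notX => zY; exists (inl z); rewrite ?inE.
have nleaf w u : w \in S -> u \notin X -> w <> inr (u, h).
  by move=> wS uX wu; rewrite wu inE (negPf uX) in wS.
have fwdE u v : u \notin Y -> v \notin X ->
    exists2 w, w \in S & dist w (inl u) = dist w (inr (v, h)).
  move=> uY vX; have [||z /eqP e] := existsP (forall_inP (forall_inP fwd u _) v _).
  - by rewrite inE uY /= -[_ \in _]negbK notX.
  - by rewrite inE vX /= -notX.
  have [w wS wz] := rep z; exists w => //.
  rewrite dist_corona_inl dist_corona_leaf; last exact: nleaf.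
  by rewrite wz e.
exists S; last first.
  move=> [u|[u l]] [v|[v k]]; rewrite !inE /= => uS vS uv; rewrite -?uv //.
  - by rewrite -uv -[_ \in _]negbK notX uS in vS.
  - by rewrite -uv -notX uS in vS.
  - by rewrite (H1 l) (H1 k).
move/vertex_cover_bisectorP: covX => covX.
move/vertex_cover_bisectorP: covY => covY.
apply/distance_equalizerP=> -[u|[u l]] [v|[v k]]; rewrite !inE ?(H1 l) ?(H1 k).
- move=> uS vS uv; have [|z e] := covY u v uS vS.
    by move=> e; rewrite e in uv.
  by have [w wS wz] := rep z; exists w; rewrite // !dist_corona_inl wz e.
- by move=> uS vS _; apply: fwdE.
- by move=> uS vS _; have [w wS e] := fwdE v u vS uS; exists w.
- move=> uS vS uv; have [|z e] := covX u v uS vS.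
    by move=> e; rewrite e in uv.
  have [w wS wz] := rep z; exists w => //.
  by rewrite !dist_corona_leaf ?wz ?e //; exact: nleaf.
Qed.

End SingletonCopy.

End Corona.

Theorem theorem22 (G H : sgraph) (hG : connected_graph G) (hH : 0 < #|H|) :
  xi (corona G H) = #|G| <->
  beta (empty_bisector G) = 0 \/ (#|H| = 1 /\ beta_star G = 0).
Proof.
have singleton : #|H| = 1 -> exists h : H, forall l, l = h.
  by move/eqP/fintype1P.
apply: (iff_trans (xi_corona_eq hG hH)).
split=> [[S eqS injS]|[/beta_empty_bisector_eq0 bis|[H1 bs0]]].
- have [H1|H_neq1] := eqVneq #|H| 1.
    right; split=> //; have [h hP] := singleton H1.
    exact: transversal_equalizer_beta_star hG h hP S eqS injS.
  left; apply/beta_empty_bisector_eq0.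
  apply: transversal_equalizer_edgeless eqS injS => //.
  by rewrite ltn_neqAle eq_sym H_neq1.
(* The vertices of [G] form a set meeting each block exactly once. *)
- exists [set w | depth w == 0]; first exact: distance_equalizer_inl.
  by move=> [u|[u l]] [v|[v k]]; rewrite !inE //= => _ _ ->.
- have [h hP] := singleton H1.
  exact: beta_star_transversal_equalizer hG h hP bs0.
Qed.
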